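(* Let $\rho\in(0,1)$, $\varepsilon_0\in(0,\min\{\rho,1-\rho\}]$ and $\kappa>0$ be fixed. There exists a positive constant $K_0=K_0(\rho,\varepsilon_0,\kappa)$ such that $$H_{\nu^n_{u(\cdot)}}(f)\le\frac1{K_0}\int\Gamma_n\sqrt f\,d\nu^n_{u(\cdot)}$$ for every $n\in\{2,3,\dots\}$, every $u\in\mathcal U^n_{\varepsilon_0,\kappa}$ and every density $f$ with respect to $\nu^n_{u(\cdot)}$.
   Context: For $n\in\{2,3,\dots\}$ let $\Lambda_n:=\{1,\dots,n-1\}$ and $\Omega_n:=\{0,1\}^{\Lambda_n}$. For $\eta\in\Omega_n$, $\eta^{x,y}$ denotes the configuration obtained from $\eta$ by exchanging the values $\eta(x)$ and $\eta(y)$, and $\eta^x$ the configuration obtained by replacing $\eta(x)$ by $1-\eta(x)$. For $f:\Omega_n\to\mathbb R$ put $\nabla_{x,y}f(\eta)=f(\eta^{x,y})-f(\eta)$ and $\nabla_xf(\eta)=f(\eta^x)-f(\eta)$. The generator of the symmetric simple exclusion process with reservoir density $\rho$ is $$\mathfrak L_nf(\eta)=n^2\sum_{x=1}^{n-2}\nabla_{x,x+1}f(\eta)+n^2\sum_{x\in\{1,n-1\}}\big(\rho(1-\eta(x))+(1-\rho)\eta(x)\big)\nabla_xf(\eta),$$ and its carré du champ is $\Gamma_nf:=\mathfrak L_nf^2-2f\,\mathfrak L_nf$ for $f:\Omega_n\to\mathbb R$. $\mathcal U^n_{\varepsilon_0,\kappa}$ is the class of functions $u:\Lambda_n\to[0,1]$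 such that $\varepsilon_0\le u(x)\le1-\varepsilon_0$ for every $x\in\Lambda_n$ and $n|u(x+1)-u(x)|\le\kappa$ for every $x\in\{1,\dots,n-2\}$. For such $u$, $\nu^n_{u(\cdot)}(\eta):=\prod_{x\in\Lambda_n}\{\eta(x)u(x)+(1-\eta(x))(1-u(x))\}$ is the Bernoulli product measure on $\Omega_n$ with density $u$. A density with respect to a probability measure $\nu$ on $\Omega_n$ is a function $f:\Omega_n\to[0,\infty)$ with $\int f\,d\nu=1$; its relative entropy is $H_\nu(f):=\int f\log f\,d\nu$ (with $0\log0=0$). *)

(* Defs.v *)
From mathcomp Require Import all_boot all_order all_algebra perm.
From mathcomp Require Import reals exp.

Set Implicit Arguments.
Unset Strict Implicit.
Unset Printing Implicit Defensive.

Import Order.TTheory GRing.Theory Num.Theory.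
Local Open Scope ring_scope.

(* The site x of {1, ..., n-1} is encoded by the ordinal of value x - 1;
   [site] recovers the position. *)
Definition Lambda (n : nat) : finType := 'I_n.-1.

Definition site (n : nat) (x : Lambda n) : nat := (nat_of_ord x).+1.

Definition Omega (n : nat) : finType := {ffun Lambda n -> bool}.

Definition exchange (n : nat) (eta : Omega n) (x y : Lambda n) : Omega n :=
  [ffun z => eta (tperm x y z)].

Definition flip (n : nat) (eta : Omega n) (x : Lambda n) : Omega n :=
  [ffun z => if z == x then ~~ eta z else eta z].

Definition nabla_exchange (R : realType) (n : nat) (x y : Lambda n)
    (f : Omega n -> R) (eta : Omega n) : R :=
  f (exchange eta x y) - f eta.

Definition nabla_flip (R : realType) (n : nat) (x : Lambda n)
    (f : Omega n -> R) (eta : Omega n) : R :=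
  f (flip eta x) - f eta.

(* The boundary sum ranges over the set {1, n-1}: when n = 2 its single
   element is counted once. *)
Definition generator (R : realType) (rho : R) (n : nat)
    (f : Omega n -> R) (eta : Omega n) : R :=
  n%:R ^+ 2 *
    (\sum_(x : Lambda n) \sum_(y : Lambda n | site y == (site x).+1)
        nabla_exchange x y f eta)
  + n%:R ^+ 2 *
    (\sum_(x : Lambda n | site x \in [:: 1%N; n.-1])
        (rho * (1 - (eta x)%:R) + (1 - rho) * (eta x)%:R)
          * nabla_flip x f eta).

Definition carre_du_champ (R : realType) (rho : R) (n : nat)
    (f : Omega n -> R) (eta : Omega n) : R :=
  generator rho (fun xi => f xi ^+ 2) eta - 2 * f eta * generator rho f eta.

Definition profile_class (R : realType) (eps0 kappa : R) (n : nat)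
    (u : Lambda n -> R) : Prop :=
  [/\ forall x, 0 <= u x <= 1,
      forall x, eps0 <= u x <= 1 - eps0
    & forall x y, site y = (site x).+1 -> n%:R * `|u y - u x| <= kappa].

Definition bernoulli_product (R : realType) (n : nat) (u : Lambda n -> R)
    (eta : Omega n) : R :=
  \prod_(x : Lambda n) ((eta x)%:R * u x + (1 - (eta x)%:R) * (1 - u x)).

(* A measure on the finite space [Omega n] is given by its mass function. *)
Definition integral (R : realType) (n : nat) (nu g : Omega n -> R) : R :=
  \sum_(eta : Omega n) g eta * nu eta.

Definition density (R : realType) (n : nat) (nu f : Omega n -> R) : Prop :=
  (forall eta, 0 <= f eta) /\ integral nu f = 1.

(* The factor [f eta] gives the convention 0 log 0 = 0. *)
Definition entropy (R : realType) (n : nat) (nu f : Omega n -> R) : R :=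
  integral nu (fun eta => f eta * ln (f eta)).

(* Main.v *)
Require Import Defs.
From mathcomp Require Import all_boot all_order all_algebra.
From mathcomp Require Import reals exp.
From mathcomp Require Import sequences perm ring lra.
Import Order.TTheory GRing.Theory Num.Theory.
Local Open Scope ring_scope.

(** Because the reservoirs create and destroy particles, no conservative
    log-Sobolev inequality is needed. Tensorizing the two-point inequality
    bounds the entropy by [2 / eps0] times the sum over all sites of the
    Glauber forms [flip_form]. A flip at [x] is then realized by carrying the
    content of [x] to site 1 through nearest-neighbour exchanges, flipping
    there, and carrying it back: at most [2 n] exchanges, each of which changes
    the product measure by a factor [1 + O(1 / n)] since [u] is Lipschitz at
    scale [n]. Hence each Glauber form costs [O(n)] times the boundary form and
    the exchange form with weight [n], and the sum over the sites is [O(n^2)],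
    which is the speed of the generator. *)

(** * Flips, exchanges and their effect on the product measure *)

Lemma flipK {n : nat} (x : Lambda n) : involutive (fun eta => flip eta x).
Proof. by move=> eta; apply/ffunP => z; rewrite !ffunE; case: eqP; rewrite ?negbK. Qed.

Lemma exchangeK {n : nat} (x y : Lambda n) : involutive (fun eta => exchange eta x y).
Proof. by move=> eta; apply/ffunP => z; rewrite !ffunE tpermK. Qed.

Lemma flipC {n : nat} (x y : Lambda n) (eta : Omega n) :
  flip (flip eta x) y = flip (flip eta y) x.
Proof. by apply/ffunP => z; rewrite !ffunE; case: ifP; case: ifP. Qed.

Lemma flip_exchange {n : nat} (x y : Lambda n) (eta : Omega n) :
  flip eta y = exchange (flip (exchange eta x y) x) x y.
Proof.
apply/ffunP => z; rewrite !ffunE.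
rewrite (tpermK x y z) -[in RHS](inj_eq (@perm_inj _ (tperm x y))).
by rewrite (tpermK x y z) (tpermL x y).
Qed.

Definition site_weight {R : realType} {n : nat} (u : Lambda n -> R)
    (x : Lambda n) (eta : Omega n) : R :=
  (eta x)%:R * u x + (1 - (eta x)%:R) * (1 - u x).

Lemma site_weight_bounds {R : realType} {n : nat} (eps : R) (u : Lambda n -> R)
    (x : Lambda n) (eta : Omega n) :
  eps <= u x <= 1 - eps -> eps <= site_weight u x eta <= 1 - eps.
Proof. by rewrite /site_weight => /andP[? ?]; case: (eta x) => /=; lra. Qed.

Lemma site_weight_flip {R : realType} {n : nat} (u : Lambda n -> R)
    (x : Lambda n) (eta : Omega n) :
  site_weight u x (flip eta x) = 1 - site_weight u x eta.
Proof. by rewrite /site_weight ffunE eqxx; case: (eta x) => /=; lra. Qed.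

Lemma site_weight_flip_neq {R : realType} {n : nat} (u : Lambda n -> R)
    (x y : Lambda n) (eta : Omega n) :
  x != y -> site_weight u y (flip eta x) = site_weight u y eta.
Proof. by rewrite /site_weight ffunE eq_sym => /negbTE ->. Qed.

Lemma bernoulli_product_ge0 {R : realType} {n : nat} (u : Lambda n -> R)
    (eta : Omega n) :
  (forall x, 0 <= u x <= 1) -> 0 <= bernoulli_product u eta.
Proof.
move=> u01; apply: prodr_ge0 => x _; have := u01 x.
by case: (eta x) => /=; lra.
Qed.

Lemma bernoulli_product_total {R : realType} {n : nat} (u : Lambda n -> R) :
  \sum_eta bernoulli_product u eta = 1.
Proof.
rewrite -(bigA_distr_bigA (fun x (b : bool) =>
  b%:R * u x + (1 - b%:R) * (1 - u x))).
by rewrite big1// => x _; rewrite big_bool /=; ring.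
Qed.

(** Detailed balance for a flip, cross-multiplied to avoid division: every factor away from [x] is
    unchanged. *)
Lemma bernoulli_product_flip {R : realType} {n : nat} (u : Lambda n -> R)
    (x : Lambda n) (eta : Omega n) :
  bernoulli_product u (flip eta x) * site_weight u x eta =
  bernoulli_product u eta * site_weight u x (flip eta x).
Proof.
rewrite /bernoulli_product (bigD1 x)//= [in RHS](bigD1 x)//=.
rewrite -/(site_weight u x eta) -/(site_weight u x (flip eta x)).
under eq_bigr => y /negbTE yx do rewrite ffunE yx.
ring.
Qed.

Lemma bernoulli_product_flip_le {R : realType} {n : nat} (eps : R)
    (u : Lambda n -> R) (x : Lambda n) (eta : Omega n) :
  0 < eps -> (forall x, eps <= u x <= 1 - eps) ->
  bernoulli_product u (flip eta x) <= eps^-1 * bernoulli_product u eta.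
Proof.
move=> eps0 ueps; rewrite mulrC ler_pdivlMr//.
have [lew _] := andP (site_weight_bounds eps u x eta (ueps x)).
have [_ w'le] := andP (site_weight_bounds eps u x (flip eta x) (ueps x)).
have nu0 zeta : 0 <= bernoulli_product u zeta.
  by apply: bernoulli_product_ge0 => y; have := ueps y; lra.
have := bernoulli_product_flip u x eta.
have := nu0 eta; have := nu0 (flip eta x); nra.
Qed.

(** Compare crosswise: after the exchange the factor at [x] reads the old occupation of [y], so it
    differs from the old factor at [y] by at most [delta]. Old factors are at least [eps], so this
    is a relative error [delta / eps], once for each of the two sites. *)
Lemma bernoulli_product_exchange_le {R : realType} {n : nat} (eps delta : R)
    (u : Lambda n -> R) (x y : Lambda n) (eta : Omega n) :
  0 < eps -> (forall z, eps <= u z <= 1 - eps) -> `|u y - u x| <= delta ->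
  x != y ->
  bernoulli_product u (exchange eta x y) <=
    (1 + delta / eps) ^+ 2 * bernoulli_product u eta.
Proof.
move=> eps0 ueps udelta xy.
have d0 : 0 <= delta by apply: le_trans udelta.
have de0 : 0 <= delta / eps by rewrite divr_ge0// ltW.
have nuE zeta : bernoulli_product u zeta = site_weight u x zeta *
    site_weight u y zeta * \prod_(z | (z != x) && (z != y)) site_weight u z zeta.
  by rewrite /bernoulli_product (bigD1 x)//= (bigD1 y)//= 1?eq_sym// mulrA.
have w_ge0 z zeta : 0 <= site_weight u z zeta.
  by have := site_weight_bounds eps u z zeta (ueps z); lra.
have -> : (1 + delta / eps) ^+ 2 * bernoulli_product u eta =
    ((1 + delta / eps) * site_weight u y eta) *
    ((1 + delta / eps) * site_weight u x eta) *
    \prod_(z | (z != x) && (z != y)) site_weight u z eta.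
  by rewrite nuE; ring.
have deltaE : delta = delta / eps * eps by rewrite divfK// gt_eqF.
rewrite nuE; under eq_bigr => z /andP[zx zy].
  rewrite /site_weight ffunE tpermD 1?eq_sym// -/(site_weight u z eta); over.
rewrite ler_wpM2r ?prodr_ge0// ler_pM//.
all: rewrite {1}/site_weight ffunE ?tpermL ?tpermR /site_weight.
all: move: udelta (ueps x) (ueps y); rewrite ler_norml.
all: case: (eta _) => /=; nra.
Qed.

(** * Integrals against a mass function *)

(** Reindexing moves [tau] from [h] onto [nu], where [c] controls the change of mass. *)
Lemma integral_involution_le {R : realType} {n : nat} (c : R)
    (nu h : Omega n -> R) (tau : Omega n -> Omega n) :
  involutive tau -> (forall eta, nu (tau eta) <= c * nu eta) ->
  (forall eta, 0 <= h eta) ->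
  integral nu (fun eta => h (tau eta)) <= c * integral nu h.
Proof.
move=> tauK nu_le h0; rewrite /integral (reindex_inj (inv_inj tauK)) mulr_sumr.
by apply: ler_sum => eta _; rewrite tauK mulrCA ler_wpM2l.
Qed.

Lemma ler_integral {R : realType} {n : nat} (nu g h : Omega n -> R) :
  (forall eta, 0 <= nu eta) -> (forall eta, g eta <= h eta) ->
  integral nu g <= integral nu h.
Proof. by move=> nu0 gh; apply: ler_sum => eta _; rewrite ler_wpM2r. Qed.

Lemma integralD {R : realType} {n : nat} (nu g h : Omega n -> R) :
  integral nu (fun eta => g eta + h eta) = integral nu g + integral nu h.
Proof. by rewrite -big_split; apply: eq_bigr => eta _; rewrite mulrDl. Qed.

Lemma integralZ {R : realType} {n : nat} (nu g : Omega n -> R) (c : R) :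
  integral nu (fun eta => c * g eta) = c * integral nu g.
Proof. by rewrite mulr_sumr; apply: eq_bigr => eta _; rewrite mulrA. Qed.

Lemma integral_sum {R : realType} {n : nat} (nu : Omega n -> R) (I : finType)
    (P : pred I) (g : I -> Omega n -> R) :
  integral nu (fun eta => \sum_(i | P i) g i eta) =
  \sum_(i | P i) integral nu (g i).
Proof.
by rewrite /integral exchange_big; apply: eq_bigr => eta _; rewrite mulr_suml.
Qed.

Lemma eq_integral {R : realType} {n : nat} (nu g h : Omega n -> R) :
  g =1 h -> integral nu g = integral nu h.
Proof. by move=> gh; apply: eq_bigr => eta _; rewrite gh. Qed.

(** * The two-point inequality and a convexity estimate *)

(** From ln z <= z - 1 at z = a / m and z = b / m, the entropy is at most variance over mean, p (1 -
    p) (b - a)^2 / m. Factor b - a through square roots; then (sqrt a + sqrt b)^2 <= 2 (a + b) <= 2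
    m / eps. *)
Lemma two_point_entropy_le {R : realType} (eps p a b : R) :
  0 < eps -> eps <= p <= 1 - eps -> 0 <= a -> 0 <= b ->
  let m := p * a + (1 - p) * b in
  p * (a * ln a) + (1 - p) * (b * ln b) - m * ln m <=
    2 / eps * (Num.sqrt b - Num.sqrt a) ^+ 2.
Proof.
move=> eps0 /andP[lep pge] a0 b0 /=; set m := p * a + _.
have mD : m = p * a + (1 - p) * b by [].
clearbody m.
have p0 : 0 < p by lra.
have q0 : 0 < 1 - p by lra.
have pa0 : 0 <= p * a by rewrite mulr_ge0// ltW.
have qb0 : 0 <= (1 - p) * b by rewrite mulr_ge0// ltW.
have lem : eps * (a + b) <= m.
  by rewrite mD mulrDr; apply: lerD; apply: ler_wpM2r => //; lra.
have rhs0 : 0 <= 2 / eps * (Num.sqrt b - Num.sqrt a) ^+ 2.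
  by rewrite mulr_ge0 ?sqr_ge0// divr_ge0// ltW.
(* If the mean vanishes, so do both p a and (1 - p) b, and the left side is 0 whatever the
   logarithms are. *)
have [mE|mN0] := eqVneq m 0.
  have pa : p * a = 0 by lra.
  have qb : (1 - p) * b = 0 by lra.
  by rewrite mE (mulrA p) (mulrA (1 - p)) pa qb !mul0r !add0r oppr0.
have m0 : 0 < m by rewrite lt_def mN0 mD addr_ge0.
have ln_le c : 0 <= c -> c * ln c - c * ln m <= c * (c / m - 1).
  move=> c0; have [->|cN0] := eqVneq c 0; first by rewrite !mul0r subrr.
  have c_gt0 : 0 < c by rewrite lt_def cN0.
  rewrite -mulrBr ler_wpM2l// -ln_div ?posrE//.
  have := @le_ln1Dx R (c / m - 1); rewrite subrKC; apply.
  by rewrite ltrBrDl subrr divr_gt0.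
have {ln_le} : p * (a * ln a) + (1 - p) * (b * ln b) - m * ln m <=
    p * (a * (a / m - 1)) + (1 - p) * (b * (b / m - 1)).
  have /= := @ler_wpM2l R _ (ltW p0) _ _ (ln_le a a0).
  have /= := @ler_wpM2l R _ (ltW q0) _ _ (ln_le b b0).
  by rewrite [X in X * ln m]mD; lra.
move=> /le_trans; apply.
have -> : p * (a * (a / m - 1)) + (1 - p) * (b * (b / m - 1)) =
    p * (1 - p) * (b - a) ^+ 2 / m.
  by rewrite mD; field; rewrite -mD.
rewrite ler_pdivrMr//.
have -> : 2 / eps * (Num.sqrt b - Num.sqrt a) ^+ 2 * m =
    2 * (Num.sqrt b - Num.sqrt a) ^+ 2 * (m / eps) by field; rewrite gt_eqF.
have : a + b <= m / eps by rewrite ler_pdivlMr// mulrC.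
have := sqr_sqrtr a0; have := sqr_sqrtr b0.
have := sqrtr_ge0 a; have := sqrtr_ge0 b.
set s := Num.sqrt a; set t := Num.sqrt b => t0 s0 tE sE.
have -> : (b - a) ^+ 2 = (t - s) ^+ 2 * (t + s) ^+ 2 by rewrite -tE -sE; ring.
move=> abm; have pq1 : p * (1 - p) <= 1 by nra.
have ts2 : (t + s) ^+ 2 <= 2 * (a + b).
  by rewrite -tE -sE -subr_ge0 (_ : _ - _ = (t - s) ^+ 2) ?sqr_ge0//; ring.
apply: (@le_trans _ _ ((t - s) ^+ 2 * (t + s) ^+ 2)).
  by rewrite -[leRHS]mul1r ler_wpM2r// mulr_ge0// sqr_ge0.
have -> : 2 * (t - s) ^+ 2 * (m / eps) = (t - s) ^+ 2 * (2 * (m / eps)) by ring.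
by rewrite ler_wpM2l ?sqr_ge0//; lra.
Qed.

(* [(a, b) |-> (sqrt a - sqrt b) ^ 2] is convex: expand the squares and apply
   Cauchy-Schwarz to the cross terms. *)
Lemma sqrt_diff_sq_convex {R : realType} (p q a b c d : R) :
  0 <= p -> 0 <= q -> 0 <= a -> 0 <= b -> 0 <= c -> 0 <= d ->
  (Num.sqrt (p * a + q * b) - Num.sqrt (p * c + q * d)) ^+ 2 <=
  p * (Num.sqrt a - Num.sqrt c) ^+ 2 + q * (Num.sqrt b - Num.sqrt d) ^+ 2.
Proof.
move=> p0 q0 a0 b0 c0 d0.
have m0 : 0 <= p * a + q * b by rewrite addr_ge0 ?mulr_ge0.
have n0 : 0 <= p * c + q * d by rewrite addr_ge0 ?mulr_ge0.
have CS : p * (Num.sqrt a * Num.sqrt c) + q * (Num.sqrt b * Num.sqrt d) <=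
    Num.sqrt (p * a + q * b) * Num.sqrt (p * c + q * d).
  rewrite -(ler_pXn2r (n := 2))// ?nnegrE ?addr_ge0 ?mulr_ge0 ?sqrtr_ge0//.
  rewrite exprMn !sqr_sqrtr//.
  rewrite -[in leRHS](sqr_sqrtr a0) -[in leRHS](sqr_sqrtr b0).
  rewrite -[in leRHS](sqr_sqrtr c0) -[in leRHS](sqr_sqrtr d0) -subr_ge0.
  rewrite (_ : _ - _ = p * q * (Num.sqrt a * Num.sqrt d -
    Num.sqrt b * Num.sqrt c) ^+ 2); last by ring.
  by rewrite mulr_ge0 ?sqr_ge0 ?mulr_ge0.
rewrite !sqrrB !sqr_sqrtr// !mulrDr !mulrN; lra.
Qed.

(** * Tensorization: averaging out one site at a time *)

(** Conditional expectation of [f] given the occupations off [x], kept as a function on all of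
    [Omega n] so that it can be iterated. *)
Definition site_avg {R : realType} {n : nat} (u : Lambda n -> R) (x : Lambda n)
    (f : Omega n -> R) (eta : Omega n) : R :=
  site_weight u x eta * f eta + site_weight u x (flip eta x) * f (flip eta x).

(** Tower property: reindex the flipped term by the flip, return to [eta] by detailed balance, and
    use that the two weights sum to 1. *)
Lemma integral_site_avg {R : realType} {n : nat} (u : Lambda n -> R)
    (x : Lambda n) (f : Omega n -> R) :
  integral (bernoulli_product u) (site_avg u x f) =
  integral (bernoulli_product u) f.
Proof.
transitivity (\sum_eta site_weight u x eta * f eta * bernoulli_product u eta +
    \sum_eta site_weight u x (flip eta x) * f (flip eta x) *
      bernoulli_product u eta).
  by rewrite -big_split; apply: eq_bigr => eta _; rewrite /= -mulrDl.
rewrite [X in _ + X](reindex_inj (inv_inj (flipK x))) -big_split.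
apply: eq_bigr => eta _ /=; rewrite (flipK x).
rewrite [X in _ + X](_ : _ = f eta * (bernoulli_product u (flip eta x) *
  site_weight u x eta)); last by ring.
rewrite bernoulli_product_flip site_weight_flip; ring.
Qed.

Lemma site_avg_ge0 {R : realType} {n : nat} (eps : R) (u : Lambda n -> R)
    (x : Lambda n) (f : Omega n -> R) :
  0 < eps -> (forall z, eps <= u z <= 1 - eps) ->
  (forall eta, 0 <= f eta) -> forall eta, 0 <= site_avg u x f eta.
Proof.
move=> eps0 ueps f0 eta; have w_ge0 zeta : 0 <= site_weight u x zeta.
  by have := site_weight_bounds eps u x zeta (ueps x); lra.
by rewrite addr_ge0 ?mulr_ge0.
Qed.

Lemma site_avg_flip {R : realType} {n : nat} (u : Lambda n -> R)
    (x : Lambda n) (f : Omega n -> R) (eta : Omega n) :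
  site_avg u x f (flip eta x) = site_avg u x f eta.
Proof. by rewrite /site_avg (flipK x) addrC. Qed.

Lemma site_avg_flip_neq {R : realType} {n : nat} (u : Lambda n -> R)
    (x y : Lambda n) (f : Omega n -> R) (eta : Omega n) : x != y ->
  site_avg u y f (flip eta x) =
  site_weight u y eta * f (flip eta x) +
  site_weight u y (flip eta y) * f (flip (flip eta y) x).
Proof. by move=> xy; rewrite /site_avg flipC !(site_weight_flip_neq u x y _ xy). Qed.

Definition flip_form {R : realType} {n : nat} (u : Lambda n -> R)
    (x : Lambda n) (g : Omega n -> R) : R :=
  integral (bernoulli_product u) (fun eta => nabla_flip x g eta ^+ 2).

(** Averaging at [y] commutes with a flip at [x], so convexity bounds the left integrand by the
    average at [y] of the right one; that average has the same integral. *)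
Lemma flip_form_site_avg_le {R : realType} {n : nat} (eps : R)
    (u : Lambda n -> R) (x y : Lambda n) (f : Omega n -> R) :
  0 < eps -> (forall z, eps <= u z <= 1 - eps) -> (forall eta, 0 <= f eta) ->
  x != y ->
  flip_form u x (fun eta => Num.sqrt (site_avg u y f eta)) <=
  flip_form u x (fun eta => Num.sqrt (f eta)).
Proof.
move=> eps0 ueps f0 xy; have w_ge0 zeta : 0 <= site_weight u y zeta.
  by have := site_weight_bounds eps u y zeta (ueps y); lra.
rewrite [leRHS]/flip_form -(integral_site_avg u y).
apply: ler_integral => eta.
  by apply: bernoulli_product_ge0 => z; have := ueps z; lra.
rewrite /nabla_flip site_avg_flip_neq// /site_avg.
exact: sqrt_diff_sq_convex.
Qed.

Lemma flip_invariant_constant {R : realType} {n : nat} (f : Omega n -> R) :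
  (forall x eta, f (flip eta x) = f eta) -> forall eta zeta, f eta = f zeta.
Proof.
move=> f_flip eta zeta.
have mix (s : seq (Lambda n)) :
    f [ffun z => if z \in s then zeta z else eta z] = f eta.
  elim: s => [|x s <-]; first by congr f; apply/ffunP => z; rewrite ffunE.
  set xi := [ffun z => if z \in s then _ else _].
  have [xiE|xiN] := eqVneq (xi x) (zeta x).
    congr f; apply/ffunP => z; rewrite ffunE inE.
    by case: (eqVneq z x) => [->|] //=; rewrite /xi ffunE.
  rewrite -(f_flip x); congr f; apply/ffunP => z; rewrite !ffunE inE.
  case: (eqVneq z x) => [->|] //=; move: xiN; rewrite /xi ffunE.
  by case: (x \in s) => //=; case: (zeta x); case: (eta x); rewrite ?eqxx.
rewrite -(mix (enum (Lambda n))); congr f.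
by apply/ffunP => z; rewrite ffunE mem_enum.
Qed.

(** Chain rule for one site: averaging f ln f at [x] keeps its integral, and its pointwise excess
    over the same expression in the averaged density is a two-point entropy with p the site
    weight. *)
Lemma site_avg_entropy_le {R : realType} {n : nat} (eps : R)
    (u : Lambda n -> R) (x : Lambda n) (f : Omega n -> R) :
  0 < eps -> (forall z, eps <= u z <= 1 - eps) -> (forall eta, 0 <= f eta) ->
  entropy (bernoulli_product u) f <=
  entropy (bernoulli_product u) (site_avg u x f) +
    2 / eps * flip_form u x (fun eta => Num.sqrt (f eta)).
Proof.
move=> eps0 ueps f0.
rewrite /entropy -(integral_site_avg u x) -integralZ -integralD.
apply: ler_integral => eta.
  by apply: bernoulli_product_ge0 => z; have := ueps z; lra.
rewrite -lerBlDl /site_avg site_weight_flip.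
apply: (two_point_entropy_le _ _ (f eta) (f (flip eta x))) => //.
exact: site_weight_bounds.
Qed.

Definition sites_avg {R : realType} {n : nat} (u : Lambda n -> R)
    (s : seq (Lambda n)) (f : Omega n -> R) : Omega n -> R :=
  foldr (site_avg u) f s.

(** Average out the sites successively. Each one costs a flip form of a partially averaged density,
    which is at most that of [f]. *)
Lemma entropy_le_flip_forms {R : realType} {n : nat} (eps : R)
    (u : Lambda n -> R) (f : Omega n -> R) :
  0 < eps -> (forall z, eps <= u z <= 1 - eps) ->
  density (bernoulli_product u) f ->
  entropy (bernoulli_product u) f <=
  2 / eps * \sum_x flip_form u x (fun eta => Num.sqrt (f eta)).
Proof.
move=> eps0 ueps [f0 f1].
have avg_ge0 s : forall eta, 0 <= sites_avg u s f eta.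
  elim: s => [|x s IH] //=; exact: (site_avg_ge0 eps).
have avg_form x s : x \notin s ->
    flip_form u x (fun eta => Num.sqrt (sites_avg u s f eta)) <=
    flip_form u x (fun eta => Num.sqrt (f eta)).
  elim: s => [|y s IH] //=; rewrite inE negb_or => /andP[xy /IH].
  by apply: le_trans; apply: (flip_form_site_avg_le eps).
have avg_flip s x : x \in s -> forall eta,
    sites_avg u s f (flip eta x) = sites_avg u s f eta.
  elim: s => //= y s IH; rewrite inE => + eta.
  have [-> _|xy /= /IH IHx] := eqVneq x y; first exact: site_avg_flip.
  by rewrite site_avg_flip_neq// /site_avg !IHx.
(* Distinctness gives [x \notin s], which [avg_form] requires to return to the original [f]. *)
have avg_entropy s : uniq s -> entropy (bernoulli_product u) f <=
    entropy (bernoulli_product u) (sites_avg u s f) +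
    2 / eps * \sum_(x <- s) flip_form u x (fun eta => Num.sqrt (f eta)).
  elim: s => [|x s IH] /=; first by rewrite big_nil mulr0 addr0.
  move=> /andP[xs /IH]; rewrite big_cons mulrDr addrA => /le_trans; apply.
  rewrite lerD2r (le_trans (site_avg_entropy_le eps u x _ eps0 ueps (avg_ge0 s)))//.
  by rewrite lerD2l ler_wpM2l ?avg_form// divr_ge0// ltW.
have := avg_entropy _ (enum_uniq (Lambda n)); rewrite big_enum /=.
(* Averaged over every site, [F] is invariant under all flips, hence constant; its integral is 1, so
   [F] is 1 and has zero entropy. *)
set F := sites_avg _ _ _; suff -> : entropy (bernoulli_product u) F = 0.
  by rewrite add0r.
have F_integral : integral (bernoulli_product u) F = 1.
  rewrite -f1 /F; elim: (enum _) => //= x s IH.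
  by rewrite integral_site_avg.
have F1 eta : F eta = 1.
  rewrite -F_integral /integral (eq_bigr (fun zeta => F eta * bernoulli_product u zeta)).
    by rewrite -mulr_sumr bernoulli_product_total mulr1.
  move=> zeta _; congr (_ * _); apply: flip_invariant_constant => x xi.
  by rewrite /F avg_flip// mem_enum.
by rewrite /entropy /integral big1// => eta _; rewrite F1 ln1 mulr0 mul0r.
Qed.

(** * Transporting a flip along exchanges to the first site *)

Definition exchange_form {R : realType} {n : nat} (u : Lambda n -> R)
    (x y : Lambda n) (g : Omega n -> R) : R :=
  integral (bernoulli_product u) (fun eta => nabla_exchange x y g eta ^+ 2).

(* A flip at [y] is an exchange of [x] and [y], a flip at [x] and the same
   exchange again; the weight [t] leaves the factor of the flip at [x] close
   to 1, so that the estimate can be iterated [n] times. *)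
Lemma flip_form_step {R : realType} {n : nat} (eps delta t : R)
    (u : Lambda n -> R) (g : Omega n -> R) (x y : Lambda n) :
  0 < eps -> (forall z, eps <= u z <= 1 - eps) -> `|u y - u x| <= delta ->
  x != y -> 0 < t ->
  flip_form u y g <=
  (1 + t) * (1 + delta / eps) ^+ 2 * flip_form u x g +
  (1 + t^-1) * (2 * ((1 + delta / eps) ^+ 2 / eps + 1)) * exchange_form u x y g.
Proof.
move=> eps0 ueps udelta xy t0.
set nu := bernoulli_product u; set c := (1 + delta / eps) ^+ 2.
have nu0 eta : 0 <= nu eta.
  by apply: bernoulli_product_ge0 => z; have := ueps z; lra.
pose sw eta := exchange eta x y; pose fl eta := flip eta x.
have c0 : 0 <= c by rewrite sqr_ge0.
have sw_le eta : nu (sw eta) <= c * nu eta.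
  exact: bernoulli_product_exchange_le.
have fl_le eta : nu (fl eta) <= eps^-1 * nu eta.
  exact: bernoulli_product_flip_le.
set A := fun eta => nabla_flip x g eta ^+ 2.
set B := fun eta => nabla_exchange x y g eta ^+ 2.
have A0 eta : 0 <= A eta by rewrite sqr_ge0.
have B0 eta : 0 <= B eta by rewrite sqr_ge0.
have pointwise eta : nabla_flip y g eta ^+ 2 <= (1 + t) * A (sw eta) +
    (1 + t^-1) * (2 * (B (fl (sw eta)) + B eta)).
  rewrite /A /B /nabla_flip /nabla_exchange (flip_exchange x y) -/(sw eta).
  rewrite -/(fl (sw eta)).
  set p := g (exchange _ _ _); set q := g (fl _); set r := g (sw eta).
  set s := g eta.
  (* The flip increment stands alone, so Young's inequality gives it the factor 1 + t; the two
     exchange increments are grouped, which produces the factor 2. *)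
  have -> : p - s = (q - r) + ((p - q) + (r - s)) by ring.
  have young (a b : R) : (a + b) ^+ 2 <= (1 + t) * a ^+ 2 + (1 + t^-1) * b ^+ 2.
    rewrite -subr_ge0 (_ : _ - _ = t^-1 * (t * a - b) ^+ 2).
      by rewrite mulr_ge0 ?sqr_ge0// invr_ge0 ltW.
    by field; rewrite gt_eqF.
  apply: (le_trans (young _ _)); rewrite lerD2l ler_wpM2l//.
    by rewrite addr_ge0// invr_ge0 ltW.
  have := sqr_ge0 ((p - q) - (r - s)); rewrite -subr_ge0; nra.
have A_le : integral nu (fun eta => A (sw eta)) <= c * flip_form u x g.
  exact: (integral_involution_le c nu A sw (exchangeK x y)).
have B_le : integral nu (fun eta => B (fl (sw eta))) <=
    c * (eps^-1 * exchange_form u x y g).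
  apply: (le_trans (integral_involution_le c nu (fun eta => B (fl eta)) sw
    (exchangeK x y) sw_le _)) => //.
  rewrite ler_wpM2l//.
  exact: (integral_involution_le eps^-1 nu B fl (flipK x)).
apply: (le_trans (ler_integral _ _ _ nu0 pointwise)).
rewrite integralD !integralZ integralD.
apply: lerD; rewrite -mulrA; first by rewrite ler_wpM2l//; lra.
rewrite ler_wpM2l ?addr_ge0 ?invr_ge0// ?(ltW t0)//.
rewrite -mulrA ler_wpM2l// mulrDl mul1r lerD// -mulrA//.
Qed.

Lemma flip_form_ge0 {R : realType} {n : nat} (u : Lambda n -> R)
    (x : Lambda n) (g : Omega n -> R) :
  (forall z, 0 <= u z <= 1) -> 0 <= flip_form u x g.
Proof.
move=> u01; apply: sumr_ge0 => eta _; rewrite mulr_ge0 ?sqr_ge0//.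
exact: bernoulli_product_ge0.
Qed.

Lemma exchange_form_ge0 {R : realType} {n : nat} (u : Lambda n -> R)
    (x y : Lambda n) (g : Omega n -> R) :
  (forall z, 0 <= u z <= 1) -> 0 <= exchange_form u x y g.
Proof.
move=> u01; apply: sumr_ge0 => eta _; rewrite mulr_ge0 ?sqr_ge0//.
exact: bernoulli_product_ge0.
Qed.

(** Induction on the distance to [x0], which is the ordinal value of [x]. Since [c >= 1], the powers
    multiplying the exchange terms can all be raised to the largest one. *)
Lemma flip_form_le_path {R : realType} {n : nat} (c D : R)
    (u : Lambda n -> R) (g : Omega n -> R) (x0 x : Lambda n) :
  (forall z, 0 <= u z <= 1) -> 1 <= c -> 0 <= D -> nat_of_ord x0 = 0%N ->
  (forall y z : Lambda n, site z = (site y).+1 ->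
    flip_form u z g <= c * flip_form u y g + D * exchange_form u y z g) ->
  flip_form u x g <= c ^+ x * (flip_form u x0 g +
    D * \sum_(y : Lambda n | (y < x)%N)
          \sum_(z : Lambda n | site z == (site y).+1) exchange_form u y z g).
Proof.
move=> u01 c1 D0 x00 step.
have E0 y z : 0 <= exchange_form u y z g by exact: exchange_form_ge0.
move: {2}(nat_of_ord x) (erefl (nat_of_ord x)) => m.
elim: m x => [|m IH] x xm.
  have -> : x = x0 by apply: val_inj; rewrite /= xm.
  rewrite x00 mul1r lerDl mulr_ge0//; apply: sumr_ge0 => y _.
  by apply: sumr_ge0.
have ym : (m < n.-1)%N by rewrite ltnW// -xm ltn_ord.
pose y : Lambda n := Ordinal ym.
have xy : site x = (site y).+1 by rewrite /site xm.
apply: (le_trans (step y x xy)).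
have splitE (f : Lambda n -> R) : \sum_(i : Lambda n | (i < x)%N) f i =
    f y + \sum_(i : Lambda n | (i < m)%N) f i.
  rewrite (bigD1 y)/=; last by rewrite xm.
  congr (_ + _); apply: eq_bigl => i.
  by rewrite xm ltnS -val_eqE /= andbC ltn_neqAle.
rewrite splitE.
rewrite (bigD1 x)/=; last by rewrite xy.
set S := \sum_(i : Lambda n | (i < m)%N) _.
have {IH} := IH y (erefl _); rewrite -/S => Fy.
(* The right neighbours of [y] other than [x]: there are none, but nonnegativity suffices. *)
set S' := \sum_(i : Lambda n | _) _.
have S'0 : 0 <= S' by apply: sumr_ge0.
rewrite xm exprS.
apply: (@le_trans _ _ (c * (c ^+ m * (flip_form u x0 g + D * S)) +
    c * c ^+ m * (D * (exchange_form u y x g + S')))).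
  apply: lerD; first by rewrite ler_wpM2l//; lra.
  have cm : 1 <= c * c ^+ m by rewrite -exprS exprn_ege1.
  rewrite -[leLHS]mul1r ler_pM ?mulr_ge0// ler_wpM2l//; lra.
by rewrite le_eqVlt; apply/orP; left; apply/eqP; ring.
Qed.

Lemma path_factor_le {R : realType} (n k : nat) (a : R) :
  (0 < n)%N -> 0 <= a -> (k <= n)%N ->
  ((1 + n%:R^-1) * (1 + a / n%:R) ^+ 2) ^+ k <= expR (1 + 2 * a).
Proof.
move=> n0 a0 kn; have nR : 0 < n%:R :> R by rewrite ltr0n.
have ni : 0 <= n%:R^-1 :> R by rewrite invr_ge0 ltW.
have an : 0 <= a / n%:R by rewrite mulr_ge0.
have c1 : 1 <= (1 + n%:R^-1) * (1 + a / n%:R) ^+ 2.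
  by rewrite mulr_ege1 ?exprn_ege1//; lra.
apply: (@le_trans _ _ (((1 + n%:R^-1) * (1 + a / n%:R) ^+ 2) ^+ n)).
  by rewrite ler_weXn2l.
(* Split the exponent into n equal parts, so that 1 + z <= exp z can be applied to each factor of
   the base. *)
have -> : 1 + 2 * a = (n%:R^-1 + 2%:R * (a / n%:R)) * n%:R.
  by field; rewrite gt_eqF.
rewrite expRM_natr expRD expRM_natl.
apply: lerXn2r; rewrite ?nnegrE ?mulr_ge0 ?expR_ge0 ?exprn_ge0 ?expR_ge0//; try lra.
by rewrite ler_pM ?exprn_ge0 ?expR_ge1Dx ?lerXn2r ?nnegrE ?expR_ge0 ?expR_ge1Dx//; lra.
Qed.

(** * The carré du champ and the final constants *)

(** For each transition, b^2 - a^2 - 2 a (b - a) = (b - a)^2; the rates just multiply this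
    identity. *)
Lemma integral_carre_du_champ {R : realType} {n : nat} (rho : R)
    (u : Lambda n -> R) (g : Omega n -> R) :
  integral (bernoulli_product u) (carre_du_champ rho g) =
  n%:R ^+ 2 * (\sum_(x : Lambda n) \sum_(y : Lambda n | site y == (site x).+1)
    exchange_form u x y g) +
  n%:R ^+ 2 * (\sum_(x : Lambda n | site x \in [:: 1%N; n.-1])
    integral (bernoulli_product u) (fun eta =>
      (rho * (1 - (eta x)%:R) + (1 - rho) * (eta x)%:R) *
        nabla_flip x g eta ^+ 2)).
Proof.
under [X in n%:R ^+ 2 * X + _]eq_bigr => x _ do rewrite -integral_sum.
rewrite -!integral_sum -!integralZ -integralD; apply: eq_integral => eta.
rewrite /carre_du_champ /generator mulrDr opprD addrACA.
rewrite !(mulrCA (2 * g eta)) -!mulrBr.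
congr (_ * _ + _ * _); rewrite mulr_sumr -sumrB; apply: eq_bigr => x _.
  rewrite mulr_sumr -sumrB; apply: eq_bigr => y _.
  by rewrite /nabla_exchange; ring.
by rewrite /nabla_flip; ring.
Qed.

(** Run the step with [delta] = kappa / n and [t] = 1 / n: the flip factor stays bounded along the
    path, while 1 + 1 / t puts a factor of order n on the exchange forms. Summing over n - 1 sites
    supplies the second n. *)
Lemma sum_flip_forms_le {R : realType} {n : nat} (eps kappa : R)
    (u : Lambda n -> R) (g : Omega n -> R) (x0 : Lambda n) :
  0 < eps -> 0 <= kappa -> profile_class eps kappa u ->
  nat_of_ord x0 = 0%N ->
  \sum_x flip_form u x g <= expR (1 + 2 * (kappa / eps)) * n%:R ^+ 2 *
    (flip_form u x0 g + 4 * ((1 + kappa / eps) ^+ 2 / eps + 1) *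
      \sum_(y : Lambda n) \sum_(z : Lambda n | site z == (site y).+1)
        exchange_form u y z g).
Proof.
move=> eps0 kappa0 [u01 ueps ukappa] x00.
set G := (1 + kappa / eps) ^+ 2 / eps + 1; set E := \sum_y _.
set a := kappa / eps.
have n1 : (0 < n)%N by case: (n) x0 {x00 E} => // -[].
have nR : 1 <= n%:R :> R by rewrite ler1n.
have nR0 : 0 < n%:R :> R by lra.
have ni : 0 <= n%:R^-1 :> R by rewrite invr_ge0 ltW.
have a0 : 0 <= a by rewrite mulr_ge0// invr_ge0 ltW.
have G0 : 0 <= G by rewrite addr_ge0// divr_ge0 ?sqr_ge0// ltW.
have E0 y z : 0 <= exchange_form u y z g by exact: exchange_form_ge0.
have F0 : 0 <= flip_form u x0 g by exact: flip_form_ge0.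
pose c : R := (1 + n%:R^-1) * (1 + a / n%:R) ^+ 2.
have an : 0 <= a / n%:R by rewrite mulr_ge0.
have step (y z : Lambda n) : site z = (site y).+1 -> flip_form u z g <=
    c * flip_form u y g + 4 * n%:R * G * exchange_form u y z g.
  move=> yz; have yNz : y != z.
    by apply: contra_eq_neq yz => ->; rewrite neq_ltn leqnn.
  have udelta : `|u z - u y| <= kappa / n%:R.
    by rewrite ler_pdivlMr// mulrC ukappa.
  have ni0 : 0 < n%:R^-1 :> R by rewrite invr_gt0.
  have := flip_form_step eps (kappa / n%:R) n%:R^-1 u g y z eps0 ueps udelta yNz ni0.
  have -> : kappa / n%:R / eps = a / n%:R by rewrite mulrAC.
  move=> /le_trans; apply; rewrite lerD2l ler_wpM2r// invrK.
  (* Uses 1 + n <= 2 n, and a / n <= a inside [G]. *)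
  have -> : 4 * n%:R * G = (2 * n%:R) * (2 * G) by ring.
  apply: ler_pM; first by lra.
  - by rewrite mulr_ge0// addr_ge0// divr_ge0 ?sqr_ge0// ltW.
  - by lra.
  rewrite ler_wpM2l// /G lerD2r ler_wpM2r ?invr_ge0 ?(ltW eps0)//.
  rewrite lerXn2r ?nnegrE ?addr_ge0// lerD2l ler_pdivrMr// -/a.
  by rewrite ler_peMr.
have c1 : 1 <= c by rewrite mulr_ege1 ?exprn_ege1//; lra.
have D0 : 0 <= 4 * n%:R * G by rewrite !mulr_ge0.
have bound x : flip_form u x g <= expR (1 + 2 * a) * n%:R *
    (flip_form u x0 g + 4 * G * E).
  apply: (le_trans (flip_form_le_path c (4 * n%:R * G) u g x0 x u01 c1 D0 x00 step)).
  set S := \sum_(y | _) _.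
  have SE : S <= E.
    rewrite /E (bigID (fun y : Lambda n => (y < x)%N))/= lerDl.
    by apply: sumr_ge0 => y _; apply: sumr_ge0.
  have S0 : 0 <= S by apply: sumr_ge0 => y _; apply: sumr_ge0.
  rewrite -[leRHS]mulrA ler_pM ?exprn_ge0 ?addr_ge0 ?mulr_ge0//; try lra.
    apply: path_factor_le => //; apply: ltnW; apply: (leq_trans (ltn_ord x)).
    exact: leq_pred.
  rewrite [leRHS]mulrDr lerD ?ler_peMl//.
  rewrite (_ : n%:R * _ = 4 * n%:R * G * E) ?ler_wpM2l//; ring.
have E_ge0 : 0 <= E by apply: sumr_ge0 => y _; apply: sumr_ge0.
apply: (le_trans (ler_sum _ (fun x _ => bound x))).
rewrite sumr_const card_ord -[leLHS]mulr_natr expr2 -!mulrA.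
rewrite ler_wpM2l ?expR_ge0// ler_wpM2l ?(ltW nR0)// mulrC ler_wpM2r//.
  by rewrite addr_ge0// !mulr_ge0.
by rewrite ler_nat leq_pred.
Qed.

(** Of the reservoir terms only the one at site 1 is kept; its rate is [rho] or [1 - rho], hence at
    least [eps]. *)
Lemma carre_du_champ_ge {R : realType} {n : nat} (rho eps : R)
    (u : Lambda n -> R) (g : Omega n -> R) (x0 : Lambda n) :
  0 < eps -> eps <= rho -> eps <= 1 - rho -> (forall z, 0 <= u z <= 1) ->
  nat_of_ord x0 = 0%N ->
  n%:R ^+ 2 * (eps * flip_form u x0 g +
    \sum_(y : Lambda n) \sum_(z : Lambda n | site z == (site y).+1)
        exchange_form u y z g) <=
  integral (bernoulli_product u) (carre_du_champ rho g).
Proof.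
move=> eps0 erho erho' u01 x00.
have nu0 eta : 0 <= bernoulli_product u eta by exact: bernoulli_product_ge0.
have rate_ge (x : Lambda n) (eta : Omega n) :
    eps <= rho * (1 - (eta x)%:R) + (1 - rho) * (eta x)%:R.
  by case: (eta x) => /=; lra.
rewrite integral_carre_du_champ -mulrDr ler_wpM2l ?sqr_ge0// addrC lerD2l.
rewrite (bigD1 x0)/=; last by rewrite /site x00.
rewrite -[leLHS]addr0 lerD//.
  rewrite -integralZ; apply: ler_integral => // eta.
  by rewrite ler_wpM2r ?sqr_ge0.
apply: sumr_ge0 => x _; apply: sumr_ge0 => eta _.
by rewrite mulr_ge0// mulr_ge0 ?sqr_ge0// (le_trans (ltW eps0)).
Qed.

Theorem theorem3p4 (R : realType) (rho eps0 kappa : R)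
  (hrho : 0 < rho < 1)
  (heps0 : 0 < eps0 <= Num.min rho (1 - rho))
  (hkappa : 0 < kappa) :
  exists2 K0 : R, 0 < K0 &
    forall (n : nat) (u : Lambda n -> R) (f : Omega n -> R),
      (2 <= n)%N ->
      profile_class eps0 kappa u ->
      density (bernoulli_product u) f ->
      entropy (bernoulli_product u) f <=
        K0^-1 * integral (bernoulli_product u)
                  (carre_du_champ rho (fun eta => Num.sqrt (f eta))).
Proof.
move: heps0; rewrite le_min => /and3P[eps0_gt0 erho erho'].
have kappa0 := ltW hkappa.
pose G := 4 * ((1 + kappa / eps0) ^+ 2 / eps0 + 1).
have G0 : 0 <= G.
  by rewrite mulr_ge0// addr_ge0// divr_ge0 ?sqr_ge0// ltW.
have ei : 0 < eps0^-1 by rewrite invr_gt0.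
(* The factors come from the two-point inequality, from the path, and from the comparison F + G E <=
   (1 / eps0 + G) (eps0 F + E) between the flip form F at site 1 and the total exchange form E. *)
pose C := 2 / eps0 * (expR (1 + 2 * (kappa / eps0)) * (eps0^-1 + G)).
have C0 : 0 < C by rewrite !mulr_gt0 ?expR_gt0 ?ltr_wpDr.
exists C^-1 => [|n u f n2 uP fP]; first by rewrite invr_gt0.
have [u01 ueps _] := uP; rewrite invrK /C.
have x0P : (0 < n.-1)%N by case: (n) n2 => [|[]].
pose x0 : Lambda n := Ordinal x0P.
set g := fun eta => Num.sqrt (f eta).
apply: (le_trans (entropy_le_flip_forms eps0 u f eps0_gt0 ueps fP)).
rewrite -[leRHS]mulrA ler_wpM2l ?mulr_ge0 ?(ltW ei)//.
apply: (le_trans (sum_flip_forms_le eps0 kappa u g x0 eps0_gt0 kappa0 uP _)) => //.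
rewrite -[leLHS]mulrA -[leRHS]mulrA ler_wpM2l ?expR_ge0//.
have := carre_du_champ_ge rho eps0 u g x0 eps0_gt0 erho erho' u01 (erefl _).
have F0 := flip_form_ge0 u x0 g u01.
set F := flip_form _ _ _ in F0 *; set E := \sum_y _.
have E0 : 0 <= E.
  by apply: sumr_ge0 => y _; apply: sumr_ge0 => z _; apply: exchange_form_ge0.
move=> Gamma_ge; have h0 : 0 <= eps0^-1 + G by rewrite addr_ge0// ltW.
apply: (@le_trans _ _ ((eps0^-1 + G) * (n%:R ^+ 2 * (eps0 * F + E)))); last first.
  by rewrite ler_wpM2l.
rewrite [leRHS]mulrCA ler_wpM2l ?sqr_ge0//.
have -> : (eps0^-1 + G) * (eps0 * F + E) = F + G * E + (eps0^-1 * E + G * (eps0 * F)).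
  by field; rewrite gt_eqF.
rewrite -/G lerDl addr_ge0// mulr_ge0// ?mulr_ge0 ?(ltW ei)//.
exact: ltW.
Qed.
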